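(* For every positive integer $n$ and every $\nu\in\mathbb{N}$, the integral $$I_n(\nu):=(\nu+1)^n\int_{\mathbb{C}^n}\left|\frac{(1+s_1\overline{s_2})\cdots(1+s_{n-1}\overline{s_n})}{(1+|s_1|^2)\cdots(1+|s_n|^2)}\right|^\nu d\iota(s_1)\cdots d\iota(s_n)$$ satisfies $I_n(\nu)\le 2^{2n}$; in particular it is bounded in $\nu$.
   Context: $d\iota(s)=\frac{dA(s)}{\pi(1+|s|^2)^2}$, where $dA$ is Lebesgue measure on $\mathbb{C}$. *)

(* Defs.v *)
(* C is modelled as R * R (s = (Re s, Im s)). *)
From HB Require Import structures.
From mathcomp Require Import all_boot all_order all_algebra.
From mathcomp Require Import all_classical all_reals all_analysis.
Set Implicit Arguments. Unset Strict Implicit. Unset Printing Implicit Defensive.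
Import Order.TTheory GRing.Theory Num.Theory.
Local Open Scope ring_scope.
Local Open Scope ereal_scope.

Section Defs.
Variable R : realType.

Definition cnorm2 (s : R * R) : R := (s.1 ^+ 2 + s.2 ^+ 2)%R.

Definition one_plus_s_conj_t (s t : R * R) : R * R :=
  (1 + (s.1 * t.1 + s.2 * t.2), s.2 * t.1 - s.1 * t.2)%R.

Definition iota_density (s : R * R) : R := ((pi * (1 + cnorm2 s) ^+ 2)^-1)%R.

(* integral of a nonnegative function against d iota over C,
   computed as an iterated Lebesgue integral over R x R (Tonelli). *)
Definition int_iota (f : R * R -> \bar R) : \bar R :=
  \int[lebesgue_measure]_x \int[lebesgue_measure]_y
     (f (x, y) * (iota_density (x, y))%:E).

(* integral over C^k against d iota(s_0) ... d iota(s_(k-1)) of F, where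
   F reads its variables s_0, ..., s_(k-1) from a sequence nat -> R*R
   (entries of index >= k are irrelevant and set to 0). *)
Fixpoint int_iota_n (k : nat) (F : (nat -> R * R) -> \bar R) : \bar R :=
  match k with
  | 0 => F (fun _ => (0, 0)%R)
  | k'.+1 => int_iota (fun s =>
       int_iota_n k' (fun t => F (fun i => if i == k' then s else t i)))
  end.

(* | (1+s_1 conj s_2)...(1+s_(n-1) conj s_n) / ((1+|s_1|^2)...(1+|s_n|^2)) |^nu
   (the modulus of the product is the product of the moduli) *)
Definition integrand (n nu : nat) (s : nat -> R * R) : R :=
  ((\prod_(i < n.-1) Num.sqrt (cnorm2 (one_plus_s_conj_t (s i) (s i.+1))))
   / (\prod_(i < n) (1 + cnorm2 (s i)))) ^+ nu.

Definition I_n (n nu : nat) : \bar R :=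
  ((nu.+1%:R ^+ n)%R)%:E * int_iota_n n (fun s => (integrand n nu s)%:E).

End Defs.

(* Main.v *)
(* Put w(s,t) = |1 + s conj(t)|^2 / ((1+|s|^2)(1+|t|^2)), so that
   1 - w(s,t) = |s-t|^2 / ((1+|s|^2)(1+|t|^2)).  The integrand is at most the
   product of the w(s_i,s_(i+1))^(nu/2), where s_(n+1) := 0 accounts for the
   last denominator; it therefore suffices that, uniformly in t, the integral
   of w(s,t)^(nu/2) d iota(s) is at most 4/(nu+4).  With k = nu/4 one has
   w^(nu/2) <= (1 + k(1-w))^(-2), and (1+|s|^2)(1 + k(1-w(s,t))) is a quadratic
   polynomial A|s-s_0|^2 + B in s with A B = 1 + k, whose inverse square has
   integral pi/(A B) over the plane.  The two one-dimensional integrals have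
   elementary antiderivatives. *)
Require Import Defs.
From HB Require Import structures.
From mathcomp Require Import all_boot all_order all_algebra.
From mathcomp Require Import all_classical all_reals all_analysis.
From mathcomp Require Import measurable_realfun ring lra.
Import Order.TTheory GRing.Theory Num.Theory numFieldNormedType.Exports.
Local Open Scope classical_set_scope.
Local Open Scope ring_scope.
Local Open Scope ereal_scope.

(** * Elementary inequalities for powers on the unit interval *)

Lemma expr_mul_le1 (R : realFieldType) (v : R) n :
  (0 <= v <= 1 -> v ^+ n * (1 + n%:R * (1 - v)) <= 1)%R.
Proof.
move=> /andP[v0 v1]; elim: n => [|n IHn]; first by rewrite expr0; lra.
(* The left-hand side is nonincreasing in [n]: one step lowers it by
   [v ^+ n * (n + 1) * (1 - v) ^+ 2]. *)
apply: le_trans IHn; rewrite exprSr -mulrA.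
apply: ler_wpM2l; first exact: exprn_ge0.
rewrite -subr_ge0 -natr1.
have -> : (1 + n%:R * (1 - v) - v * (1 + (n%:R + 1) * (1 - v)) =
  (n%:R + 1) * (1 - v) ^+ 2)%R by ring.
by rewrite mulr_ge0 ?addr_ge0 ?sqr_ge0.
Qed.

(** With [v] the square root of [u], both sides are squares, and [1 - v ^+ 4 <= 4 * (1 - v)] reduces
    the claim to [expr_mul_le1]; this is where the 4 comes from. *)
Lemma expr_le_inv_sqr (R : rcfType) (u : R) n : (0 <= u <= 1 ->
  u ^+ n <= (1 + n%:R / 4 * (1 - u ^+ 2)) ^- 2)%R.
Proof.
move=> /andP[u0 u1].
have u2 : (u ^+ 2 <= 1)%R by rewrite expr_le1.
have k0 : (0 <= n%:R / 4 * (1 - u ^+ 2))%R.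
  by rewrite mulr_ge0 ?divr_ge0 ?subr_ge0.
rewrite -[leRHS]mul1r ler_pdivlMr ?exprn_gt0 ?ltr_pwDl//.
set v := Num.sqrt u.
have uE : u = (v ^+ 2)%R by rewrite sqr_sqrtr.
have v01 : (0 <= v <= 1)%R by rewrite sqrtr_ge0 -sqrtr1 ler_wsqrtr.
have vn0 : (0 <= v ^+ n)%R by case/andP: v01 => v0 _; rewrite exprn_ge0.
have -> : (u ^+ n = (v ^+ n) ^+ 2)%R by rewrite uE -!exprM mulnC.
rewrite -exprMn expr_le1// ?mulr_ge0 ?addr_ge0//.
apply: le_trans (expr_mul_le1 _ _ n v01); apply: ler_wpM2l => //.
rewrite lerD2l -mulrA; apply: ler_wpM2l => //.
case/andP: v01 => v0 v1; rewrite uE.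
have -> : (1 - (v ^+ 2) ^+ 2 = (1 - v) * ((1 + v) * (1 + v ^+ 2)))%R by ring.
have v2 : (v ^+ 2 <= 1)%R by rewrite expr_le1.
have h : ((1 + v) * (1 + v ^+ 2) <= 4)%R by nra.
have : ((1 - v) * ((1 + v) * (1 + v ^+ 2)) <= (1 - v) * 4)%R.
  by apply: ler_wpM2l => //; rewrite subr_ge0.
lra.
Qed.

(* Read off from the definition of the integral by suprema over simple functions,
   so that it applies to the inner integrals as functions of the outer variable. *)
Lemma le_integralT d (T : measurableType d) (R : realType)
    (mu : {measure set T -> \bar R}) (f g : T -> \bar R) :
  (forall x, f x <= g x) -> \int[mu]_x f x <= \int[mu]_x g x.
Proof.
move=> fg; rewrite /integral !patch_setT; apply: leeB.
  apply: ereal_sup_le => _ /= [h hf <-]; exists h => // x.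
  by apply: le_trans (hf x) _; apply: (@funepos_le _ _ setT); rewrite ?inE.
apply: ereal_sup_le => _ /= [h hf <-]; exists h => // x.
by apply: le_trans (hf x) _; apply: (@funeneg_le _ _ setT); rewrite ?inE.
Qed.

(** * Integrals over the line bounded through bounded antiderivatives *)

Section antiderivative.
Context {R : realType}.
Implicit Types (f F : R -> R) (M : R).
Let mu := @lebesgue_measure R.

Lemma is_derive_continuous f F :
  (forall x : R, is_derive x 1%R F (f x)) -> continuous F.
Proof.
move=> dF x; apply/differentiable_continuous/derivable1_diffP.
by have [] := dF x.
Qed.

Lemma ge0_is_derive_ndecr f F : (forall x, 0 <= f x)%R ->
  (forall x : R, is_derive x 1%R F (f x)) -> {homo F : x y / (x <= y)%R}.
Proof.
move=> f0 dF x y xy.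
apply: (@ger0_derive1_ndecr _ F x y) => //.
- by move=> z _; rewrite derive1E; have [_ ->] := dF z.
- exact/continuous_subspaceT/(is_derive_continuous f).
Qed.

(** [F] is nondecreasing and bounded, so it converges to the supremum of its range; the integral is
    [sup (range F) - F 0], and the limit need not be computed. *)
Lemma ge0_integral_itvcy_le f F M : continuous f -> (forall x, 0 <= f x)%R ->
  (forall x : R, is_derive x 1%R F (f x)) -> (forall x, F x <= M)%R ->
  \int[mu]_(x in `[0%R, +oo[) (f x)%:E <= (M - F 0)%:E.
Proof.
move=> cf f0 dF FM.
have ubF : has_ubound (range F) by exists M => _ [x _ <-].
rewrite (@ge0_continuous_FTC2y _ f F 0%R (sup (range F))) //.
- rewrite -EFinB lee_fin lerD2r; apply: ge_sup; first by exists (F 0%R), 0%R.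
  by move=> _ [x _ <-].
- exact: continuous_subspaceT.
- exact: (nondecreasing_cvgr (ge0_is_derive_ndecr f F f0 dF)).
- exact/cvg_at_right_filter/(is_derive_continuous f).
- by move=> x _; rewrite derive1E; have [_ ->] := dF x.
Qed.

Lemma ge0_integralT_le f F M : continuous f -> (forall x, 0 <= f x)%R ->
  (forall x : R, is_derive x 1%R F (f x)) -> (forall x, `|F x| <= M)%R ->
  \int[mu]_x (f x)%:E <= (2 * M)%:E.
Proof.
move=> cf f0 dF FM.
have mf : measurable_fun [set: R] f by exact: continuous_measurable_fun.
have mp : measurable [set x : R | 0 <= x]%R by rewrite -set_itvcy.
rewrite -(setUv [set x : R | 0 <= x]%R) ge0_integral_setU//= ; last 4 first.
  exact: measurableC.
  by apply/measurable_EFinP; rewrite setUv.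
  by move=> x _; rewrite lee_fin.
  exact/disj_setPCl.
rewrite -set_itvcy// setCitvr.
rewrite integral_itv_bndo_bndc; last exact/measurable_EFinP/measurable_funTS.
(* The endpoint 0 is written [- 0] to match the reflection of the negative half-line, where
   [- F (- x)] serves as antiderivative; the values of [F] at 0 then cancel. *)
rewrite -{2}oppr0 ge0_integration_by_substitutionNy//; last first.
  exact: continuous_subspaceT.
have -> : (2 * M = (M - F 0) + (M - (- F (- 0))))%R by rewrite oppr0; ring.
rewrite EFinD; apply: leeD.
  by apply: ge0_integral_itvcy_le => // x; exact: le_trans (ler_norm _) (FM x).
apply: (@ge0_integral_itvcy_le (f \o -%R) (fun x => - F (- x))%R).
- by move=> x; apply: continuous_comp; [exact: continuousN|exact: cf].
- by move=> x; exact: f0.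
- move=> x; have dFx := dF (- x)%R.
  have -> : (f \o -%R) x = (- (f (- x) * -1))%R by rewrite /=; ring.
  exact: (@is_deriveN _ _ _ (F \o -%R)).
- by move=> x; apply: le_trans (FM (- x)%R); rewrite -normrN ler_norm.
Qed.

Lemma ge0_integralT_affine_le f F M (k r x0 : R) :
  continuous f -> (forall x, 0 <= f x)%R ->
  (forall x : R, is_derive x 1%R F (f x)) -> (forall x, `|F x| <= M)%R ->
  (0 <= k)%R -> (0 < r)%R ->
  \int[mu]_x (k * f (r * (x - x0)))%:E <= (2 * (k * M / r))%:E.
Proof.
move=> cf f0 dF FM k0 r0.
apply: (@ge0_integralT_le _ (fun x => k / r * F (r * (x - x0)))%R).
- move=> x; apply: continuousM; first exact: cvg_cst.
  apply: (@continuous_comp _ _ _ (fun x => r * (x - x0))%R f); last exact: cf.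
  apply: continuousM; first exact: cvg_cst.
  by apply: continuousB; [exact: cvg_id|exact: cvg_cst].
- by move=> x; rewrite mulr_ge0.
- move=> x; have dFx := dF (r * (x - x0))%R.
  have dg : is_derive x 1%R (fun x => r * (x - x0))%R r.
    by apply: (@is_derive_eq _ _ _ _ _ _ r (r *: (1 - 0))%R);
      rewrite ?subr0 ?scaler1.
  have -> : (k * f (r * (x - x0)) = k / r *: (f (r * (x - x0)) * r))%R.
    by rewrite /GRing.scale/=; field; rewrite gt_eqF.
  exact: (@is_deriveZ _ _ _ (F \o (fun x => r * (x - x0))%R)).
- move=> x; rewrite normrM ger0_norm ?divr_ge0 ?(ltW r0)//.
  by rewrite [leRHS]mulrAC ler_wpM2l// ?divr_ge0 ?(ltW r0).
Qed.

End antiderivative.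

(** * The two explicit antiderivatives and their bounds *)

Section explicit_antiderivatives.
Context {R : realType}.
Implicit Types z : R.

Let oneD_gt0 z : (0 < 1 + z ^+ 2)%R. Proof. by rewrite ltr_pwDl ?sqr_ge0. Qed.
Let oneD_neq0 z : (1 + z ^+ 2 != 0)%R. Proof. by rewrite gt_eqF. Qed.

Let derive_oneDsqr z : is_derive z 1%R (fun z => 1 + z ^+ 2)%R (2 * z)%R.
Proof.
have dX := @is_deriveX _ _ id 2 z 1%R _ (is_derive_id z 1%R).
have := @is_deriveD _ _ _ _ _ z 1%R _ _ (is_derive_cst (1%R : R) z 1%R) dX.
move=> /is_derive_eq; apply.
by rewrite /GRing.scale/= expr1 mulr1 add0r.
Qed.

Let continuous_oneDsqr : continuous (fun z : R => 1 + z ^+ 2)%R.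
Proof. by apply: (@is_derive_continuous _ (fun z => 2 * z)%R). Qed.

Lemma continuous_oneDsqr_exprV n :
  continuous (fun z : R => (1 + z ^+ 2) ^- n)%R.
Proof.
move=> z; apply: (@cvgV _ _ _ _ (fun z : R => (1 + z ^+ 2) ^+ n)%R).
  by rewrite expf_neq0.
apply: (@continuous_comp _ _ _ (fun z => 1 + z ^+ 2)%R (fun z => z ^+ n)%R).
  exact: continuous_oneDsqr.
exact: exprn_continuous.
Qed.

Definition atan_primitive z : R := (2^-1 * (z / (1 + z ^+ 2) + atan z))%R.

Lemma derive_atan_primitive z :
  is_derive z 1%R atan_primitive ((1 + z ^+ 2) ^- 2)%R.
Proof.
have dV := @is_deriveV _ (fun z => 1 + z ^+ 2)%R z _ _
  (oneD_neq0 z) (derive_oneDsqr z).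
have dM : is_derive z 1%R (fun z => z / (1 + z ^+ 2))%R _ :=
  @is_deriveM _ _ _ (fun z => (1 + z ^+ 2)^-1)%R z 1%R _ _
    (is_derive_id z 1%R) dV.
have dD : is_derive z 1%R (fun z => z / (1 + z ^+ 2) + atan z)%R _ :=
  @is_deriveD _ _ _ _ _ z 1%R _ _ dM (is_derive1_atan z).
have dZ : is_derive z 1%R atan_primitive _ :=
  @is_deriveZ _ _ _ _ (2^-1)%R z 1%R _ dD.
move: dZ => /is_derive_eq; apply; rewrite /GRing.scale/=; field.
exact: oneD_neq0.
Qed.

Lemma atan_primitiveN z : atan_primitive (- z)%R = (- atan_primitive z)%R.
Proof. by rewrite /atan_primitive atanN sqrrN; ring. Qed.

(** The bound is only approached at infinity. By monotonicity [z] may be moved right to some [w] at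
    least [e^-1], where the rational term is at most [e] and [atan w < pi / 2]. *)
Lemma atan_primitive_le z : (atan_primitive z <= pi / 4)%R.
Proof.
apply/ler_addgt0Pr => e e0.
pose w := Num.max z (e^-1)%R.
have w0 : (0 < w)%R by rewrite lt_max invr_gt0 e0 orbT.
have zw : (z <= w)%R by rewrite le_max lexx.
have f0 (y : R) : (0 <= (1 + y ^+ 2) ^- 2)%R by rewrite invr_ge0 sqr_ge0.
have := ge0_is_derive_ndecr _ _ f0 derive_atan_primitive _ _ zw.
move=> /le_trans; apply; rewrite /atan_primitive.
have we : (w / (1 + w ^+ 2) <= e)%R.
  have ew : (1 <= e * w)%R.
    by rewrite -ler_pdivrMl// mulr1 le_max lexx orbT.
  rewrite ler_pdivrMr//; nra.
have := atan_ltpi2 w; lra.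
Qed.

Lemma norm_atan_primitive_le z : (`|atan_primitive z| <= pi / 4)%R.
Proof.
by rewrite ler_norml lerNl -atan_primitiveN !atan_primitive_le.
Qed.

Lemma continuous_sqrt_oneDsqr_exprV n :
  continuous (fun z : R => Num.sqrt (1 + z ^+ 2) ^- n)%R.
Proof.
move=> z; apply: (@cvgV _ _ _ _ (fun z : R => Num.sqrt (1 + z ^+ 2) ^+ n)%R).
  by rewrite expf_neq0// gt_eqF// sqrtr_gt0.
apply: (@continuous_comp _ _ _ (fun z => Num.sqrt (1 + z ^+ 2))%R
  (fun z => z ^+ n)%R); last exact: exprn_continuous.
apply: (@continuous_comp _ _ _ (fun z => 1 + z ^+ 2)%R Num.sqrt).
  exact: continuous_oneDsqr.
exact: sqrt_continuous.
Qed.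

Lemma derive_div_sqrt_oneDsqr z : is_derive z 1%R
  (fun z => z / Num.sqrt (1 + z ^+ 2))%R (Num.sqrt (1 + z ^+ 2) ^- 3)%R.
Proof.
have s0 : (Num.sqrt (1 + z ^+ 2) != 0)%R by rewrite gt_eqF// sqrtr_gt0.
have dS : is_derive z 1%R (fun z => Num.sqrt (1 + z ^+ 2))%R _ :=
  @is_derive1_comp _ Num.sqrt (fun z => 1 + z ^+ 2)%R z _ _
    (is_derive1_sqrt (oneD_gt0 z)) (derive_oneDsqr z).
have dV := @is_deriveV _ (fun z => Num.sqrt (1 + z ^+ 2))%R z _ _ s0 dS.
have dM : is_derive z 1%R (fun z => z / Num.sqrt (1 + z ^+ 2))%R _ :=
  @is_deriveM _ _ _ (fun z => (Num.sqrt (1 + z ^+ 2))^-1)%R z 1%R _ _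
    (is_derive_id z 1%R) dV.
move: dM => /is_derive_eq; apply; rewrite /GRing.scale/=.
have := sqr_sqrtr (ltW (oneD_gt0 z)).
move: s0; set s := Num.sqrt _ => s0 sE.
(* Eliminating [z ^+ 2] leaves an identity rational in the root [s]. *)
have zE : (z ^+ 2 = s ^+ 2 - 1)%R by rewrite sE; ring.
transitivity ((s ^+ 2 - z ^+ 2) / s ^+ 3)%R; first by field.
by rewrite zE; field.
Qed.

Lemma norm_div_sqrt_oneDsqr_le z : (`|z / Num.sqrt (1 + z ^+ 2)| <= 1)%R.
Proof.
rewrite normrM normfV (ger0_norm (sqrtr_ge0 _)) ler_pdivrMr ?sqrtr_gt0//.
by rewrite mul1r -sqrtr_sqr ler_wsqrtr// lerDr.
Qed.

End explicit_antiderivatives.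

(** * The planar integral of an inverse squared quadratic *)

Section kernel.
Context {R : realType}.
Implicit Types s t u : R * R.
Let mu := @lebesgue_measure R.

(** With [e ^+ 2 = 1 + A / B * (x - x0) ^+ 2] the quadratic is [B * e ^+ 2 + A * (y - y0) ^+ 2].
    Integrating in [y] with [atan_primitive] leaves a multiple of [e ^- 3], which is integrated in
    [x] with [z / Num.sqrt (1 + z ^+ 2)]. *)
Lemma plane_integral_quadratic_le (A B a x0 y0 : R) :
  (0 < A)%R -> (0 < B)%R -> (0 <= a)%R ->
  \int[mu]_x \int[mu]_y
    (a * (A * ((x - x0) ^+ 2 + (y - y0) ^+ 2) + B) ^- 2)%:E <=
  (pi * a / (A * B))%:E.
Proof.
move=> A0 B0 a0.
(* The roots of [A] and [B] make the scaling factors of both integrals rational expressions. *)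
have [ra ra0 AE] : exists2 ra : R, (0 < ra)%R & (ra ^+ 2 = A)%R.
  by exists (Num.sqrt A); rewrite ?sqrtr_gt0// sqr_sqrtr// ltW.
have [rb rb0 BE] : exists2 rb : R, (0 < rb)%R & (rb ^+ 2 = B)%R.
  by exists (Num.sqrt B); rewrite ?sqrtr_gt0// sqr_sqrtr// ltW.
have ran := lt0r_neq0 ra0; have rbn := lt0r_neq0 rb0.
have inner x : \int[mu]_y
    (a * (A * ((x - x0) ^+ 2 + (y - y0) ^+ 2) + B) ^- 2)%:E <=
    (pi * a / (2 * ra * rb ^+ 3) *
      Num.sqrt (1 + (ra / rb * (x - x0)) ^+ 2) ^- 3)%:E.
  have h0 : (0 < 1 + (ra / rb * (x - x0)) ^+ 2)%R by rewrite ltr_pwDl ?sqr_ge0.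
  have e0 : (0 < Num.sqrt (1 + (ra / rb * (x - x0)) ^+ 2))%R.
    by rewrite sqrtr_gt0.
  have := sqr_sqrtr (ltW h0); move: (Num.sqrt _) e0 => e e0 eE.
  have en := lt0r_neq0 e0.
  have eE' : ((x - x0) ^+ 2 = (e ^+ 2 - 1) * (rb / ra) ^+ 2)%R.
    by rewrite eE; field; rewrite ran rbn.
  have -> : (pi * a / (2 * ra * rb ^+ 3) * e ^- 3 =
      2 * (a / (rb * e) ^+ 4 * (pi / 4) / (ra / (rb * e))))%R.
    by field; rewrite ran rbn en.
  have QE (y : R) : (a * (A * ((x - x0) ^+ 2 + (y - y0) ^+ 2) + B) ^- 2 =
      a / (rb * e) ^+ 4 * (1 + (ra / (rb * e) * (y - y0)) ^+ 2) ^- 2)%R.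
    rewrite -mulrA -invfM; congr (_ / _)%R.
    by rewrite eE' -AE -BE; field; rewrite ran rbn en.
  under eq_integral do rewrite QE.
  apply: (@ge0_integralT_affine_le _ (fun z => (1 + z ^+ 2) ^- 2)%R
            atan_primitive).
  - exact: continuous_oneDsqr_exprV.
  - by move=> z; rewrite invr_ge0 sqr_ge0.
  - exact: derive_atan_primitive.
  - exact: norm_atan_primitive_le.
  - by rewrite divr_ge0// exprn_ge0// mulr_ge0// ltW.
  - by rewrite divr_gt0// mulr_gt0.
apply: le_trans; first by apply: le_integralT => x; exact: inner.
have -> : (pi * a / (A * B) =
    2 * (pi * a / (2 * ra * rb ^+ 3) * 1 / (ra / rb)))%R.
  by rewrite -AE -BE; field; rewrite ran rbn.
apply: (@ge0_integralT_affine_le _ (fun z => Num.sqrt (1 + z ^+ 2) ^- 3)%R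
  (fun z => z / Num.sqrt (1 + z ^+ 2))%R).
- exact: continuous_sqrt_oneDsqr_exprV.
- by move=> z; rewrite invr_ge0 exprn_ge0// sqrtr_ge0.
- exact: derive_div_sqrt_oneDsqr.
- exact: norm_div_sqrt_oneDsqr_le.
- by rewrite divr_ge0 ?mulr_ge0 ?pi_ge0 ?exprn_ge0 ?(ltW ra0) ?(ltW rb0).
- exact: divr_gt0.
Qed.

(** * The overlap kernel and chains of overlaps *)

Lemma cnorm2_ge0 s : (0 <= cnorm2 s)%R.
Proof. by rewrite addr_ge0 ?sqr_ge0. Qed.

Lemma cnorm2D1_gt0 s : (0 < 1 + cnorm2 s)%R.
Proof. by rewrite ltr_pwDl ?cnorm2_ge0. Qed.

(* The squared cosine of the Fubini-Study distance between s and t. *)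
Definition overlap s t : R :=
  (cnorm2 (one_plus_s_conj_t s t) / ((1 + cnorm2 s) * (1 + cnorm2 t)))%R.

(** This is the identity $|1+s\bar t|^2 + |s-t|^2 = (1+|s|^2)(1+|t|^2)$. *)
Lemma overlapE s t : overlap s t =
  (1 - ((s.1 - t.1) ^+ 2 + (s.2 - t.2) ^+ 2) /
         ((1 + cnorm2 s) * (1 + cnorm2 t)))%R.
Proof.
have s0 := lt0r_neq0 (cnorm2D1_gt0 s); have t0 := lt0r_neq0 (cnorm2D1_gt0 t).
rewrite /overlap; move: s0 t0; rewrite /cnorm2/= => s0 t0.
by field; rewrite s0 t0.
Qed.

Lemma overlap_ge0 s t : (0 <= overlap s t)%R.
Proof. by rewrite divr_ge0 ?mulr_ge0 ?cnorm2_ge0// ltW// cnorm2D1_gt0. Qed.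

Lemma overlap_le1 s t : (overlap s t <= 1)%R.
Proof.
rewrite overlapE gerBl divr_ge0 ?addr_ge0 ?sqr_ge0//.
by rewrite mulr_ge0// ltW// cnorm2D1_gt0.
Qed.

(* Multiplying by 1 + |s|^2 turns 1 + k (1 - overlap s t) into a quadratic
   polynomial in s; completing the square gives the centre and constant used
   here. *)
Lemma int_iota_overlap_le (f : R * R -> \bar R) (k a : R) t :
  (0 <= k)%R -> (0 <= a)%R ->
  (forall s, f s <= (a * (1 + k * (1 - overlap s t)) ^- 2)%:E) ->
  int_iota f <= (a / (1 + k))%:E.
Proof.
move=> k0 a0 fle; case: t fle => p q fle.
have T0 := cnorm2D1_gt0 (p, q).
have [A AE] : exists A : R, A = (1 + k / (1 + cnorm2 (p, q)))%R by eexists.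
have A0 : (0 < A)%R by rewrite AE ltr_pwDl// divr_ge0// ltW.
have k1 : (0 < 1 + k)%R by rewrite ltr_pwDl.
have B0 : (0 < (1 + k) / A)%R by rewrite divr_gt0.
pose x0 := (k * p / ((1 + cnorm2 (p, q)) * A))%R.
pose y0 := (k * q / ((1 + cnorm2 (p, q)) * A))%R.
(* The factor $1/\pi$ of the density goes into the constant and cancels the [pi] of the planar
   integral. *)
have -> : (a / (1 + k) = pi * (a / pi) / (A * ((1 + k) / A)))%R.
  by rewrite [(pi * _)%R]mulrC [(A * _)%R]mulrC !divfK ?gt_eqF ?pi_gt0.
have api0 : (0 <= a / pi)%R by rewrite divr_ge0 ?pi_ge0.
apply: le_trans;
  last exact: (@plane_integral_quadratic_le A _ (a / pi)%R x0 y0 A0 B0 api0).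
apply: le_integralT => x; apply: le_integralT => y.
have S0 := cnorm2D1_gt0 (x, y).
have d0 : (0 <= iota_density (x, y))%R.
  by rewrite invr_ge0 mulr_ge0 ?pi_ge0 ?sqr_ge0.
apply: le_trans (lee_wpmul2r _ (fle (x, y))) _; first by rewrite lee_fin.
rewrite -EFinM lee_fin le_eqVlt; apply/orP; left; apply/eqP.
rewrite /iota_density -!mulrA -!invfM; congr (_ / _)%R.
rewrite mulrCA -exprMn; congr (_ * _ ^+ 2)%R.
rewrite overlapE /=.
have An := lt0r_neq0 A0; have Tn := lt0r_neq0 T0; have Sn := lt0r_neq0 S0.
(* This is [(1 + cnorm2 (p, q)) * A], the denominator of the centre once [A] is unfolded. *)
have Un : (1 + cnorm2 (p, q) + k != 0)%R by rewrite gt_eqF// ltr_wpDr.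
rewrite /x0 /y0.
transitivity (1 + cnorm2 (x, y) +
    k / (1 + cnorm2 (p, q)) * ((x - p) ^+ 2 + (y - q) ^+ 2))%R.
  by field; rewrite Tn Sn.
move: An Tn Un; rewrite AE /cnorm2 /= => An Tn Un.
by field; rewrite Un Tn.
Qed.

(** The outermost variable [s] is the last of the chain. For fixed [s] the inner integral is a
    shorter chain ending at [s], with the factor of [overlap s u] moved into the constant; hence the
    induction over all [a] and [u]. *)
Lemma int_iota_n_chain_le (nu k : nat) (F : (nat -> R * R) -> \bar R)
    (a : R) u :
  (0 <= a)%R ->
  (forall t : nat -> R * R, F t <= (a * \prod_(i < k)
     Num.sqrt (overlap (t i) (if i.+1 == k then u else t i.+1)) ^+ nu)%:E) ->
  int_iota_n k F <= (a / (1 + nu%:R / 4) ^+ k)%:E.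
Proof.
elim: k F a u => [|k IHk] F a u a0 Fle /=.
  by apply: le_trans (Fle _) _; rewrite big_ord0 mulr1 expr0 divr1.
have c0 : (0 < 1 + nu%:R / 4 :> R)%R by rewrite ltr_pwDl ?divr_ge0.
rewrite exprS invfM [(_^-1 * _)%R]mulrC mulrA.
apply: (@int_iota_overlap_le _ _ _ u); rewrite ?divr_ge0 ?exprn_ge0 ?(ltW c0)//.
move=> s; apply: le_trans.
  apply: (IHk _ (a * Num.sqrt (overlap s u) ^+ nu)%R s).
    by rewrite mulr_ge0 ?exprn_ge0 ?sqrtr_ge0.
  move=> t; apply: le_trans (Fle _) _.
  rewrite big_ord_recr/= !eqxx lee_fin mulrA mulrAC le_eqVlt; apply/orP; left.
  apply/eqP; congr (_ * _)%R.
  (* For [i < k], position [i] still reads [t i], while position [i.+1] reads [s] exactly when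
     [i.+1 = k]: [s] is the new end of the chain. *)
  apply: eq_bigr => i _; rewrite ltn_eqF//= eqSS.
  by rewrite (ltn_eqF (ltn_ord i)).
rewrite lee_fin mulrAC ler_wpM2l ?divr_ge0 ?exprn_ge0 ?(ltW c0)//.
rewrite -{2}(sqr_sqrtr (overlap_ge0 s u)); apply: expr_le_inv_sqr.
by rewrite sqrtr_ge0 -sqrtr1 ler_wsqrtr ?overlap_le1.
Qed.

(* Each interior 1 + |s_i|^2 is shared between two consecutive overlaps, so only
   square roots at both ends are left over. *)
Lemma overlap_chainE n (s : nat -> R * R) :
  ((\prod_(i < n) Num.sqrt (cnorm2 (one_plus_s_conj_t (s i) (s i.+1))))
   / (\prod_(i < n.+1) (1 + cnorm2 (s i))) * Num.sqrt (1 + cnorm2 (s 0%N)) =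
  (\prod_(i < n) Num.sqrt (overlap (s i) (s i.+1))) /
    Num.sqrt (1 + cnorm2 (s n)))%R.
Proof.
have h0 i : (Num.sqrt (1 + cnorm2 (s i)) != 0)%R.
  by rewrite gt_eqF// sqrtr_gt0 cnorm2D1_gt0.
have hE i : (1 + cnorm2 (s i) = Num.sqrt (1 + cnorm2 (s i)) ^+ 2)%R.
  by rewrite sqr_sqrtr// ltW// cnorm2D1_gt0.
elim: n => [|n IHn].
  rewrite !big_ord0 big_ord_recr big_ord0/= !mul1r {1}hE.
  by field.
rewrite big_ord_recr [in X in (_ / X)%R]big_ord_recr/= invfM.
rewrite [in RHS]big_ord_recr/=.
have -> : Num.sqrt (overlap (s n) (s n.+1)) =
   (Num.sqrt (cnorm2 (one_plus_s_conj_t (s n) (s n.+1))) /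
     (Num.sqrt (1 + cnorm2 (s n)) * Num.sqrt (1 + cnorm2 (s n.+1))))%R.
  rewrite /overlap sqrtrM ?cnorm2_ge0//.
  rewrite sqrtrV ?mulr_ge0 ?(ltW (cnorm2D1_gt0 _))//.
  by rewrite sqrtrM// ltW// cnorm2D1_gt0.
rewrite mulrACA [LHS]mulrAC IHn [in LHS](hE n.+1).
by field; rewrite !h0.
Qed.

Lemma integrand_le (n nu : nat) (s : nat -> R * R) : (0 < n)%N ->
  (integrand n nu s <= \prod_(i < n)
     Num.sqrt (overlap (s i) (if i.+1 == n then (0, 0) else s i.+1)) ^+ nu)%R.
Proof.
case: n => [//|n] _; rewrite /integrand /= prodrXl.
have num0 : (0 <= (\prod_(i < n)
    Num.sqrt (cnorm2 (one_plus_s_conj_t (s i) (s i.+1))))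
   / (\prod_(i < n.+1) (1 + cnorm2 (s i))))%R.
  apply: divr_ge0; apply: prodr_ge0 => i _; first exact: sqrtr_ge0.
  exact/ltW/cnorm2D1_gt0.
(* An overlap with 0 is [1 / (1 + cnorm2 (s n))], so the closing factor of the chain supplies the
   root left over at the right end. *)
have -> : (\prod_(i < n.+1)
    Num.sqrt (overlap (s i) (if i.+1 == n.+1 then (0, 0) else s i.+1)) =
  (\prod_(i < n) Num.sqrt (overlap (s i) (s i.+1))) /
    Num.sqrt (1 + cnorm2 (s n)))%R.
  rewrite big_ord_recr/= eqxx; congr (_ * _)%R.
    by apply: eq_bigr => i _; rewrite eqSS (ltn_eqF (ltn_ord i)).
  rewrite /overlap /one_plus_s_conj_t /cnorm2 /= !mulr0 !expr0n/=.
  rewrite subr0 !addr0 expr1n mulr1 expr0n/= addr0 mul1r sqrtrV//.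
  exact/ltW/cnorm2D1_gt0.
(* The only loss is the factor [Num.sqrt (1 + cnorm2 (s 0))], which is at least 1. *)
rewrite -overlap_chainE; apply: lerXn2r => //; rewrite ?nnegrE//.
  by rewrite mulr_ge0// sqrtr_ge0.
by rewrite ler_peMr// -[leLHS]sqrtr1 ler_wsqrtr// lerDl cnorm2_ge0.
Qed.

End kernel.

Theorem mainTheorem7 (R : realType) (n nu : nat) (hn : (0 < n)%N) :
  I_n R n nu <= ((2 ^+ (2 * n))%R : R)%:E.
Proof.
have c0 : (0 < 1 + nu%:R / 4 :> R)%R by rewrite ltr_pwDl ?divr_ge0.
have chain : int_iota_n n (fun s => (integrand n nu s : R)%:E) <=
    (1 / (1 + nu%:R / 4) ^+ n)%:E.
  apply: (@int_iota_n_chain_le _ nu n _ _ (0, 0)%R) => // t.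
  by rewrite lee_fin mul1r integrand_le.
apply: le_trans (lee_wpmul2l _ chain) _; first by rewrite lee_fin exprn_ge0.
rewrite -EFinM lee_fin mul1r -expr_div_n exprM.
(* Both sides are [n]-th powers, and [nu + 1 <= 4 * (1 + nu / 4) = nu + 4] compares the bases. *)
apply: lerXn2r; rewrite ?nnegrE ?divr_ge0 ?(ltW c0)//.
by rewrite ler_pdivrMr// -natr1; lra.
Qed.
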